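(* Let $K$ be a field, let $n\ge 3$ be fixed, and let $A=K\vec A_n/\mathcal I$ be a bound quiver algebra of the linearly oriented quiver $\vec A_n$, where $\mathcal I$ is an admissible ideal generated by a set of zero relations. Then $1\le \mathrm{dom.dim}\,A\le n-1$.
   Context: $\vec A_n$ denotes the linearly oriented quiver $1\to 2\to\cdots\to n$. A zero relation is a relation consisting of a single path of length at least two (which is set to zero). Modules are finite dimensional left modules. For a module $M$ and an integer $k\ge 1$, write $\mathrm{dom.dim}\,M\ge k$ if $M$ has a minimal injective resolution $0\to M\to I_1\to I_2\to\cdots$ such that $I_1,\dots,I_k$ are all projective (zero modules count as projective). If $I_1$ is not projective, $\mathrm{dom.dim}\,M=0$; if $\mathrm{dom.dim}\,M\ge k$ but not $\ge k+1$, then $\mathrm{dom.dim}\,M=k$; if no such finite $k$ exists, $\mathrm{dom.dim}\,M=\infty$. The dominant dimension of an algebra $A$ is $\mathrm{dom.dim}\,A:=\mathrm{dom.dim}({}_AA)$. *)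

(* Defs.v *)
From HB Require Import structures.
From mathcomp Require Import all_boot all_order all_algebra.

Set Implicit Arguments.
Unset Strict Implicit.
Unset Printing Implicit Defensive.

Import GRing.Theory.
Local Open Scope ring_scope.

(* The linearly oriented quiver 1 -> 2 -> ... -> n, with vertices 'I_n        *)
(* (numbered from 0). There is exactly one path from i to j when i <= j, of   *)
(* length j - i, and none otherwise, so a path is a pair (i, j) with i <= j.  *)

Definition qpath (n : nat) : predArgType :=
  {p : 'I_n * 'I_n | (p.1 <= p.2)%N}.

Definition source n (p : qpath n) : 'I_n := (val p).1.
Definition target n (p : qpath n) : 'I_n := (val p).2.
Definition path_length n (p : qpath n) : nat := target p - source p.

(* p is the path "r, followed by q" *)
Definition is_concat n (p q r : qpath n) : bool :=
  [&& source r == source p, target r == source q & target q == target p].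

(* The path algebra: the K-vector space on all paths, where the product q * r *)
(* of two paths is "r, followed by q" if r ends where q starts, and 0         *)
(* otherwise. With this convention left modules are representations of the    *)
(* quiver 1 -> ... -> n. The opposite convention yields the same class of     *)
(* bound quiver algebras, after renumbering i as n + 1 - i.                   *)
(* The values are in K^o for the sake of the K-module structure; the          *)
(* multiplication is not the pointwise one of {ffun _ -> K}.                  *)

Definition path_algebra (K : fieldType) (n : nat) : Type :=
  {ffun qpath n -> K^o}.

HB.instance Definition _ (K : fieldType) (n : nat) :=
  Vector.copy (path_algebra K n) {ffun qpath n -> K^o}.

Section PathAlgebraRing.
Variables (K : fieldType) (n : nat).
Implicit Types (x y z : path_algebra K n) (p q r : qpath n) (i j k : 'I_n).

Definition path_elt p : path_algebra K n := [ffun q => (q == p)%:R].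

Definition path_algebra_one : path_algebra K n :=
  [ffun p => (source p == target p)%:R].

Definition path_algebra_mul x y : path_algebra K n :=
  [ffun p => \sum_q \sum_(r | is_concat p q r) (x q : K) * (y r : K)].

(* The ring axioms are transported from lower triangular matrices. *)
Definition path_algebra_mx x : 'M[K]_n :=
  \matrix_(i, j) if insub (j, i) is Some p then x (p : qpath n) else 0.

Lemma path_algebra_mxE x p : path_algebra_mx x (target p) (source p) = x p.
Proof. by rewrite mxE -surjective_pairing valK. Qed.

Lemma path_algebra_mx_inj : injective path_algebra_mx.
Proof. by move=> x y exy; apply/ffunP=> p; rewrite -!path_algebra_mxE exy. Qed.

Lemma path_algebra_mx_gt x i j : (i < j)%N -> path_algebra_mx x i j = 0.
Proof. by move=> lt_ij; rewrite mxE insubF //= leqNgt lt_ij. Qed.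

Lemma path_algebra_mxD : {morph path_algebra_mx : x y / x + y}.
Proof.
move=> x y; apply/matrixP=> i j; rewrite !mxE.
by case: insub => [p|]; rewrite ?ffunE ?addr0.
Qed.

Lemma path_algebra_mx1 : path_algebra_mx path_algebra_one = 1%:M.
Proof.
apply/matrixP=> i j; rewrite !mxE; case: insubP => [p /= _ vp|/=].
  by rewrite ffunE /source /target [val p]vp /= eq_sym.
by case: eqVneq => // ->; rewrite leqnn.
Qed.

Lemma sum_path_algebra x (F : 'I_n -> 'I_n -> K) :
  \sum_q (x q : K) * F (target q) (source q) =
  \sum_i \sum_j path_algebra_mx x i j * F i j.
Proof.
rewrite pair_big /=.
rewrite (bigID (fun ij : 'I_n * 'I_n => (ij.2 <= ij.1)%N)) /=.
rewrite [X in _ + X]big1 ?addr0; last first.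
  by move=> ij; rewrite -ltnNge => /path_algebra_mx_gt->; rewrite mul0r.
have [p0 _|no_path] := pickP (@predT (qpath n)); last first.
  rewrite big1 => [|q]; last by have := no_path q.
  rewrite big1 // => ij le_ji.
  by have := no_path (exist _ (ij.2, ij.1) le_ji).
rewrite (reindex_onto (fun q : qpath n => (target q, source q))
  (fun ij => insubd p0 (ij.2, ij.1))) /=; last first.
  by move=> [i j] /= le_ji; rewrite /target /source val_insubd /= le_ji.
apply: eq_big => [q|q _]; last by rewrite path_algebra_mxE.
by rewrite (valP q) -surjective_pairing valKd eqxx.
Qed.

Lemma path_algebra_mxM x y :
  path_algebra_mx (path_algebra_mul x y) =
  path_algebra_mx x *m path_algebra_mx y.
Proof.
have mulE p : path_algebra_mul x y p =
    \sum_k path_algebra_mx x (target p) k * path_algebra_mx y k (source p).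
  rewrite ffunE.
  pose G i j : K := \sum_(r : qpath n)
    y r * ((source r == source p) && (target r == j) && (i == target p))%:R.
  transitivity (\sum_q x q * G (target q) (source q)).
    apply: eq_bigr => q _; rewrite /G mulr_sumr big_mkcond /=.
    apply: eq_bigr => r _; rewrite /is_concat andbA.
    by case: ifP => _; rewrite ?mulr1 // !mulr0.
  rewrite sum_path_algebra (bigD1 (target p)) //= [X in _ + X]big1 ?addr0.
    apply: eq_bigr => k _; congr (_ * _).
    rewrite /G (sum_path_algebra y (fun i j =>
      ((j == source p) && (i == k) && (target p == target p))%:R)).
    rewrite (bigD1 k) //= [X in _ + X]big1 ?addr0; last first.
      by move=> i /negPf nik; apply: big1 => j _; rewrite nik andbF mulr0.
    rewrite (bigD1 (source p)) //= [X in _ + X]big1 ?addr0.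
      by rewrite !eqxx mulr1.
    by move=> j /negPf njp; rewrite njp mulr0.
  move=> i /negPf nip; apply: big1 => j _; rewrite /G big1 ?mulr0 // => r _.
  by rewrite nip andbF mulr0.
apply/matrixP=> i j; have [le_ji|lt_ij] := leqP j i.
  pose p : qpath n := exist _ (j, i) le_ji.
  by rewrite -[i in LHS]/(target p) -[j in LHS]/(source p) path_algebra_mxE
             mulE mxE.
rewrite path_algebra_mx_gt // mxE big1 // => k _.
have [lt_ik|le_ki] := ltnP i k; first by rewrite path_algebra_mx_gt ?mul0r.
by rewrite [X in _ * X]path_algebra_mx_gt ?mulr0 // (leq_ltn_trans le_ki).
Qed.

Fact path_algebra_mulA : associative path_algebra_mul.
Proof.
by move=> x y z; apply: path_algebra_mx_inj; rewrite !path_algebra_mxM mulmxA.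
Qed.

Fact path_algebra_mul1x : left_id path_algebra_one path_algebra_mul.
Proof.
move=> x; apply: path_algebra_mx_inj.
by rewrite path_algebra_mxM path_algebra_mx1 mul1mx.
Qed.

Fact path_algebra_mulx1 : right_id path_algebra_one path_algebra_mul.
Proof.
move=> x; apply: path_algebra_mx_inj.
by rewrite path_algebra_mxM path_algebra_mx1 mulmx1.
Qed.

Fact path_algebra_mulDl : left_distributive path_algebra_mul +%R.
Proof.
move=> x y z; apply: path_algebra_mx_inj.
by rewrite !(path_algebra_mxM, path_algebra_mxD) mulmxDl.
Qed.

Fact path_algebra_mulDr : right_distributive path_algebra_mul +%R.
Proof.
move=> x y z; apply: path_algebra_mx_inj.
by rewrite !(path_algebra_mxM, path_algebra_mxD) mulmxDr.
Qed.

(* Only a pzRingType, because the path algebra is trivial for n = 0. *)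
HB.instance Definition _ := GRing.Zmodule_isPzRing.Build (path_algebra K n)
  path_algebra_mulA path_algebra_mul1x path_algebra_mulx1
  path_algebra_mulDl path_algebra_mulDr.

End PathAlgebraRing.

(* Two-sided ideals, as Prop-valued predicates. *)
Section Ideals.
Variable R : pzRingType.
Implicit Types (J S : R -> Prop).

Definition two_sided_ideal J : Prop :=
  [/\ J 0, forall x y, J x -> J y -> J (x + y)
    & forall a x, J x -> J (a * x) /\ J (x * a)].

Definition ideal_generated S (x : R) : Prop :=
  forall J, two_sided_ideal J -> (forall s, S s -> J s) -> J x.

Definition ideal_power J (m : nat) : R -> Prop :=
  ideal_generated (fun x => exists2 t : m.-tuple R,
    (forall i, J (tnth t i)) & x = \prod_(a <- t) a).

End Ideals.

Section BoundQuiver.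
Variables (K : fieldType) (n : nat).
Implicit Types I : path_algebra K n -> Prop.

Definition arrow_ideal : path_algebra K n -> Prop :=
  ideal_generated
    (fun x => exists2 p : qpath n, path_length p = 1%N & x = path_elt K p).

Definition admissible I : Prop :=
  [/\ two_sided_ideal I,
      exists2 m : nat, (2 <= m)%N & forall x, ideal_power arrow_ideal m x -> I x
    & forall x, I x -> ideal_power arrow_ideal 2 x].

Definition generated_by_zero_relations I : Prop :=
  exists2 rho : {set qpath n},
    forall p, p \in rho -> (2 <= path_length p)%N
  & forall x, I x <->
      ideal_generated (fun y => exists2 p, p \in rho & y = path_elt K p) x.

(* A is the quotient algebra of the path algebra by I, with projection pi. *)
Definition is_quotient_algebra I (A : algType K) (pi : path_algebra K n -> A) :=
  [/\ linear pi, monoid_morphism pi, forall a, exists x, pi x = a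
    & forall x, pi x = 0 <-> I x].

End BoundQuiver.

Section Modules.
Variables (K : fieldType) (A : algType K).

(* Finite dimensional over K, which acts on M through k |-> k%:A. *)
Definition fin_dim (M : lmodType A) : Prop :=
  exists (d : nat) (e : 'I_d -> M),
    forall m, exists c : 'I_d -> K, m = \sum_i (c i)%:A *: e i.

Record fdmod := FdMod {
  fdmod_sort :> lmodType A;
  fdmodP : fin_dim fdmod_sort
}.

Definition projective_mod (P : fdmod) : Prop :=
  forall (X Y : fdmod) (g : {linear X -> Y}) (f : {linear P -> Y}),
    (forall y, exists x, g x = y) ->
    exists h : {linear P -> X}, forall p, g (h p) = f p.

Definition injective_mod (I : fdmod) : Prop :=
  forall (X Y : fdmod) (g : {linear X -> Y}) (f : {linear X -> I}),
    injective g -> exists h : {linear Y -> I}, forall x, h (g x) = f x.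

Definition submodule (M : lmodType A) (N : M -> Prop) : Prop :=
  N 0 /\ forall (a : A) u v, N u -> N v -> N (a *: u + v).

Definition essential_image (X Y : lmodType A) (f : X -> Y) : Prop :=
  forall N : Y -> Prop, submodule N -> (exists2 y, N y & y != 0) ->
    exists x, N (f x) /\ f x != 0.

Definition exact_at (X Y Z : lmodType A) (f : X -> Y) (g : Y -> Z) : Prop :=
  forall y, g y = 0 <-> exists x, f x = y.

(* 0 -> M -> I_0 -> I_1 -> ...; the indices are those of the usual I_1, I_2,  *)
(* ... shifted by one. Minimality says that each term is an injective         *)
(* envelope of the image of the map into it.                                  *)
Record min_inj_resolution (M : lmodType A) := MinInjResolution {
  res_term : nat -> fdmod;
  res_aug : {linear M -> res_term 0};
  res_diff : forall k, {linear res_term k -> res_term k.+1};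
  res_injective : forall k, injective_mod (res_term k);
  res_aug_inj : injective res_aug;
  res_exact0 : exact_at res_aug (res_diff 0);
  res_exact : forall k, exact_at (res_diff k) (res_diff k.+1);
  res_min0 : essential_image res_aug;
  res_min : forall k, essential_image (res_diff k)
}.

Definition dom_dim_ge (M : lmodType A) (k : nat) : Prop :=
  exists I : min_inj_resolution M,
    forall i, (i < k)%N -> projective_mod (res_term I i).

(* The dominant dimension of M is d, where None stands for infinity. *)
Definition dom_dim_is (M : lmodType A) (d : option nat) : Prop :=
  match d with
  | Some 0 => ~ dom_dim_ge M 1
  | Some k => dom_dim_ge M k /\ ~ dom_dim_ge M k.+1
  | None => forall k, (1 <= k)%N -> dom_dim_ge M k
  end.

Definition alg_dom_dim_is : option nat -> Prop := dom_dim_is (A^o : lmodType A).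

End Modules.

(* Main.v *)
From HB Require Import structures.
From mathcomp Require Import all_boot all_order all_algebra.
From mathcomp Require Import zify.
From Stdlib Require Import Classical.
Require Import Defs.

(**
The algebra A has a basis made of the paths that stay nonzero in the quotient;
they are closed under subpaths and contain all vertices and arrows. A set Q of
consecutive vertices such that the path from any of them to any later one is
nonzero carries an indecomposable module, with one basis vector per vertex and
socle at the last vertex m of Q. Its injective envelope is carried by the set
[hull Q] of all j such that the path from j to m is nonzero, and the cokernel by
[hull Q] minus Q, which is again such a set. Starting from the n sets carrying
the indecomposable summands of A (for each i, the vertices reached from i by a
nonzero path) and iterating yields an explicit minimal injective resolution of
A. Its terms are modules of n-by-n matrices, where row i follows the i-th
summand and the support of the rows is prescribed ([interval_mod]).

Lower bound. The hull of the vertices reached from i is also the set of vertices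
reached from a, for the smallest a with a nonzero path to m
([hull_arrows_projective]). Hence the first term is projective.

Upper bound. In any minimal injective resolution the last vertex where a term
can live moves down by at least one at each step, because a vector at the last
vertex spans a simple submodule and so comes from the previous term
([resolution_support]). Hence the term of index n vanishes. If the n terms
before it were all projective, the resolution would split from its end down
([regular_pred]) and A would be a direct summand of an injective module. But A
is not injective: its simple projective summand at the last vertex n sits in the
socle of its hull, which also contains the vertex n - 1
([regular_not_injective]).
*)

Set Implicit Arguments.
Unset Strict Implicit.
Unset Printing Implicit Defensive.

Import GRing.Theory.
Local Open Scope ring_scope.

(** * Intervals of nonzero paths and their hulls *)

(** The combinatorial data of the bound quiver: which paths from s to t are not
    killed by the relations. Indexing by natural numbers rather than ordinals
    keeps the reasoning on intervals within linear arithmetic. *)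
Record path_pred (n : nat) := PathPred {
  nonzero_path :> rel nat;
  nz_le : forall s t, nonzero_path s t -> (s <= t)%N;
  nz_lt : forall s t, nonzero_path s t -> (t < n)%N;
  nz_sub : forall s s' t' t, nonzero_path s t ->
    (s <= s')%N -> (s' <= t')%N -> (t' <= t)%N -> nonzero_path s' t';
  nz_vertex : forall s, (s < n)%N -> nonzero_path s s;
  nz_arrow : forall s, (s.+1 < n)%N -> nonzero_path s s.+1
}.

Section Intervals.
Variables (n : nat) (nz : path_pred n).
Implicit Types (Q : pred nat) (i j k m s t : nat).

(** The supports of the modules with one-dimensional top and socle. The empty
    set is admitted: it stands for the zero module once a resolution stops. *)
Definition is_interval Q : Prop :=
  (forall s t, Q s -> Q t -> (s <= t)%N -> nz s t)
  /\ (forall s k t, Q s -> Q t -> (s <= k <= t)%N -> Q k).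

(** The support of the injective envelope. The conditions on m single out the
    last element of Q, that is, the socle of the module. *)
Definition hull Q : pred nat :=
  fun j => has (fun m => [&& Q m, ~~ Q m.+1 & nz j m]) (iota 0 n).

Definition cosyzygy Q : pred nat := fun j => hull Q j && ~~ Q j.

Lemma interval_lt Q j : is_interval Q -> Q j -> (j < n)%N.
Proof. by case=> nzQ _ Qj; exact: nz_lt (nzQ j j Qj Qj (leqnn j)). Qed.

Lemma interval_arrows i : is_interval (nz i).
Proof.
split=> [s t nzs nzt le_st|s k t nzs nzt /andP[le_sk le_kt]].
  exact: nz_sub nzt (nz_le nzs) le_st (leqnn t).
exact: nz_sub nzt (leqnn i) (leq_trans (nz_le nzs) le_sk) le_kt.
Qed.

Lemma interval_arrows_to m : is_interval (nz^~ m).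
Proof.
split=> [s t nzs nzt le_st|s k t nzs nzt /andP[le_sk le_kt]] /=.
  exact: nz_sub nzs (leqnn s) le_st (nz_le nzt).
exact: nz_sub nzs le_sk (leq_trans le_kt (nz_le nzt)) (leqnn m).
Qed.

Lemma eq_interval Q Q' : Q =1 Q' -> is_interval Q -> is_interval Q'.
Proof.
move=> eQ [h1 h2]; split=> [s t|s k t]; rewrite -!eQ; first exact: h1.
exact: h2.
Qed.

Lemma interval_top Q q : is_interval Q -> Q q ->
  exists m, [/\ Q m, ~~ Q m.+1 & (q <= m)%N].
Proof.
move=> iQ; move: {-1}(n - q)%N (leqnn (n - q)) => b.
elim: b q => [|b IHb] q le_b Qq; first by have := interval_lt iQ Qq; lia.
have [Qq1|nQq1] := boolP (Q q.+1); last by exists q.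
have [||m [Qm nQm lt_qm]] := IHb q.+1 => //; first by lia.
by exists m; split=> //; apply: ltnW.
Qed.

Lemma hullP Q j :
  reflect (exists m, [/\ Q m, ~~ Q m.+1 & nz j m]) (hull Q j).
Proof.
apply: (iffP hasP) => [[m _ /and3P[]]|[m [Qm nQm nzm]]]; first by exists m.
by exists m; [rewrite mem_iota (nz_lt nzm) | rewrite Qm nQm].
Qed.

Lemma hullE Q m : is_interval Q -> Q m -> ~~ Q m.+1 -> hull Q =1 nz^~ m.
Proof.
move=> [_ cQ] Qm nQm j; apply/hullP/idP => [[m' [Qm' nQm' nzm']]|nzm].
  have [lt_m|lt_m|-> //] := ltngtP m m'.
    by case/negP: nQm; apply: (cQ m _ m') => //; lia.
  by case/negP: nQm'; apply: (cQ m' _ m) => //; lia.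
by exists m.
Qed.

Lemma hull_cases Q : is_interval Q ->
  (exists2 m, Q m & hull Q =1 nz^~ m) \/ hull Q =1 xpred0.
Proof.
move=> iQ; have [[q Qq]|noQ] := classic (exists q, Q q).
  have [m [Qm nQm _]] := interval_top iQ Qq.
  by left; exists m => //; apply: hullE.
by right=> j; apply/hullP=> -[m [Qm _ _]]; apply: noQ; exists m.
Qed.

Lemma sub_hull Q j : is_interval Q -> Q j -> hull Q j.
Proof.
move=> iQ Qj; have [m [Qm nQm le_jm]] := interval_top iQ Qj.
by rewrite (hullE iQ Qm nQm); apply: iQ.1.
Qed.

Lemma hull_interval Q : is_interval Q -> is_interval (hull Q).
Proof.
move=> iQ; case: (hull_cases iQ) => [[m _ eH]|eH].
  by apply: eq_interval (interval_arrows_to m) => j; rewrite eH.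
by split=> [s t|s k t]; rewrite !eH.
Qed.

(** The cokernel of the injective envelope lives before the module itself, as Q
    already contains every vertex from any of its elements to its last one. *)
Lemma cosyzygy_lt Q q j : is_interval Q -> Q q -> cosyzygy Q j -> (j < q)%N.
Proof.
move=> [_ cQ] Qq /andP[/hullP[m [Qm _ nzm]] nQj]; rewrite ltnNge.
apply/negP=> le_qj; case/negP: nQj; apply: (cQ q _ m) => //.
by rewrite le_qj (nz_le nzm).
Qed.

Lemma cosyzygy_down Q j k : is_interval Q ->
  hull Q j -> cosyzygy Q k -> (j <= k)%N -> cosyzygy Q j.
Proof.
move=> iQ Hj ck le_jk; rewrite /cosyzygy Hj /=; apply/negP=> Qj.
by have := cosyzygy_lt iQ Qj ck; lia.
Qed.

Lemma cosyzygy_interval Q : is_interval Q -> is_interval (cosyzygy Q).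
Proof.
move=> iQ; have iH := hull_interval iQ; split=> [s t|s k t].
  by move=> /andP[Hs _] /andP[Ht _]; apply: iH.1.
move=> cs ct /andP[le_sk le_kt]; apply: (cosyzygy_down iQ _ ct le_kt).
by case/andP: cs ct => Hs _ /andP[Ht _]; apply: iH.2 Hs Ht _; rewrite le_sk.
Qed.

Lemma hull_up Q j k : is_interval Q -> Q j -> hull Q k -> (j <= k)%N -> Q k.
Proof.
move=> iQ Qj Hk le_jk; apply/negPn/negP=> nQk.
by have := @cosyzygy_lt Q j k iQ Qj; rewrite /cosyzygy Hk nQk; lia.
Qed.

(** Consecutive hulls meet exactly in the cosyzygy. This is what makes the
    restriction of coordinates from one hull to the next an exact sequence. *)
Lemma hull_cosyzygy Q j : is_interval Q ->
  hull Q j -> hull (cosyzygy Q) j = ~~ Q j.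
Proof.
move=> iQ Hj; apply/idP/idP => [/hullP[m [cm _ nzm]]|nQj].
  by have := cosyzygy_down iQ Hj cm (nz_le nzm); rewrite /cosyzygy Hj.
by apply: sub_hull; [apply: cosyzygy_interval | rewrite /cosyzygy Hj].
Qed.

(** The combinatorial reason for dominant dimension at least one. If m is the
    last vertex reached from i, and a the first one from which m is reached,
    then m is also the last vertex reached from a: a longer nonzero path from a would
    contain a nonzero path from i to the vertex after m. *)
Lemma hull_arrows_projective i : (i < n)%N ->
  exists2 a, (a < n)%N & hull (nz i) =1 nz a.
Proof.
move=> lt_in; have iQ := interval_arrows i.
have [m [nzim nm le_im]] := interval_top iQ (nz_vertex nz lt_in).
have exm : exists a, nz a m by exists i.
case: (ex_minnP exm) => a nzam min_a.
exists a => [|j]; first by have := nz_le nzam; have := nz_lt nzam; lia.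
rewrite (hullE iQ nzim nm); apply/idP/idP=> [nzjm|nzaj].
  exact: nz_sub nzam (leqnn a) (min_a _ nzjm) (nz_le nzjm).
have [le_jm|lt_mj] := leqP j m; first exact: nz_sub nzam (nz_le nzaj) le_jm _.
by case/negP: nm; apply: (nz_sub nzaj) (min_a _ nzim) _ lt_mj; lia.
Qed.

End Intervals.

(** * Functionals on finite dimensional modules *)

Lemma fin_dim_fin (K : fieldType) (A : algType K) (M : lmodType A)
    (T : finType) (e : T -> M) :
  (forall m, exists c : T -> K, m = \sum_i (c i)%:A *: e i) -> fin_dim M.
Proof.
move=> span; exists #|T|, (e \o enum_val) => m; have [c ->] := span m.
by exists (c \o enum_val); rewrite (reindex _ (onW_bij _ (enum_val_bij T))).
Qed.

Section ScalarAction.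
Variables (K : fieldType) (A : algType K) (M : lmodType A).
Implicit Types (c : K) (x y : M).

Lemma algZA c c' x : c%:A *: (c'%:A *: x) = (c * c')%:A *: x.
Proof. by rewrite scalerA mulr_algl scalerA. Qed.

Lemma algZ0 x : (0 : K)%:A *: x = 0.
Proof. by rewrite !scale0r. Qed.

Lemma algZ1 x : (1 : K)%:A *: x = x.
Proof. by rewrite !scale1r. Qed.

Lemma algZDl c c' x : (c + c')%:A *: x = c%:A *: x + c'%:A *: x.
Proof. by rewrite !scalerDl. Qed.

Lemma algZC c (a : A) x : c%:A *: (a *: x) = a *: (c%:A *: x).
Proof. by rewrite !scalerA mulr_algl mulr_algr. Qed.

Lemma algZ c (a : A) x : (c *: a) *: x = c%:A *: (a *: x).
Proof. by rewrite scalerA mulr_algl. Qed.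

(** K acts on an A-module through the scalars of A, so coordinate vectors over K
    are combined by hand. *)
Definition comb d (e : 'I_d -> M) (u : 'rV[K]_d) : M :=
  \sum_i (u 0 i)%:A *: e i.

Lemma comb_linear d (e : 'I_d -> M) c u v :
  comb e (c *: u + v) = c%:A *: comb e u + comb e v.
Proof.
rewrite /comb scaler_sumr -big_split; apply: eq_bigr => i _ /=.
by rewrite !mxE algZDl algZA.
Qed.

Definition lin_indep d (e : 'I_d -> M) : Prop :=
  forall u, comb e u = 0 -> u = 0.

Lemma lin_indep_inj d (e : 'I_d -> M) : lin_indep e -> injective (comb e).
Proof.
move=> indep_e u v euv; apply/eqP; rewrite -subr_eq0; apply/eqP/indep_e.
by rewrite addrC -scaleN1r comb_linear euv !scaleN1r addNr.
Qed.

(** A dependent spanning family can be shortened by one vector. The boolean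
    equality lets a canonical coordinate vector be chosen. *)
Lemma fin_dim_basis : fin_dim M ->
  exists (d : nat) (e : 'I_d -> M),
    lin_indep e /\ forall m, exists u, m == comb e u.
Proof.
case=> d [e span_e]; have {span_e}: forall m, exists u, m == comb e u.
  move=> m; have [c ->] := span_e m; exists (\row_i c i); apply/eqP.
  by apply: eq_bigr => i _; rewrite mxE.
elim: d e => [|d IHd] e span_e.
  by exists 0, e; split=> // u _; apply/rowP=> -[].
have [indep_e|] := classic (lin_indep e); first by exists d.+1, e.
move=> /not_all_ex_not[u nu];
  have [eu0 /eqP/rV0Pn[j nzu]] := imply_to_and _ _ nu.
apply: (IHd (fun i => e (lift j i))) => m; have [v /eqP->] := span_e m.
pose w := v - (v 0 j / u 0 j) *: u.
have ew : comb e w = comb e v.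
  by rewrite /w addrC -scaleNr comb_linear eu0 scaler0 add0r.
exists (\row_i w 0 (lift j i)); apply/eqP; rewrite -ew /comb.
rewrite (bigD1_ord j) //= [w 0 j](_ : _ = 0) ?algZ0 ?add0r.
  by apply: eq_bigr => i _; rewrite mxE.
by rewrite !mxE divfK // subrr.
Qed.

End ScalarAction.

Definition functional (K : fieldType) (A : algType K) (M : lmodType A)
    (phi : M -> K) : Prop :=
  forall (c : K) x y, phi (c%:A *: x + y) = c * phi x + phi y.

Lemma functional_comb (K : fieldType) (A : algType K) (M : lmodType A)
    (phi : M -> K) d (e : 'I_d -> M) u :
  functional phi -> phi (comb e u) = \sum_i u 0 i * phi (e i).
Proof.
move=> phiL; have phi0 : phi 0 = 0.
  have := phiL 1 0 0; rewrite scaler0 addr0 mul1r => /eqP.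
  by rewrite -subr_eq0 opprD addNKr oppr_eq0 => /eqP.
rewrite /comb; elim/big_rec2: _ => // i _ x _ <-; exact: phiL.
Qed.

(** Injectivity of K as a K-module, which is the source of injectivity for the
    modules over A. In coordinates, g becomes a matrix G and phi a column killed
    by the row kernel of G; then pinvmx G times that column is an extension,
    since G *m pinvmx G acts as the identity modulo this kernel. *)
Lemma functional_extension (K : fieldType) (A : algType K) (X Y : fdmod A)
    (g : {linear X -> Y}) (phi : X -> K) :
  injective g -> functional phi ->
  exists2 psi : Y -> K, functional psi & forall x, psi (g x) = phi x.
Proof.
move=> inj_g phiL.
have [dX [eX [_ spanX]]] := fin_dim_basis (fdmodP X).
have [dY [e [indep_e span_e]]] := fin_dim_basis (fdmodP Y).
pose coord y := xchoose (span_e y).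
have coordK y : comb e (coord y) = y.
  by apply/esym/eqP/(xchooseP (span_e y)).
have coordL c x y : coord (c%:A *: x + y) = c *: coord x + coord y.
  by apply: (lin_indep_inj indep_e); rewrite comb_linear !coordK.
pose G := \matrix_(i, j) coord (g (eX i)) 0 j : 'M[K]_(dX, dY).
pose Phi := \col_i phi (eX i).
have gE u : g (comb eX u) = comb e (u *m G).
  rewrite /comb linear_sum.
  transitivity (\sum_i \sum_j (u 0 i * G i j)%:A *: e j).
    apply: eq_bigr => i _; rewrite linearZ /= -[g (eX i)]coordK scaler_sumr.
    by apply: eq_bigr => j _; rewrite algZA mxE.
  rewrite exchange_big; apply: eq_bigr => j _ /=.
  by rewrite -scaler_suml mxE; congr (_ *: _); rewrite scaler_suml.
have phiE u : phi (comb eX u) = (u *m Phi) 0 0.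
  by rewrite functional_comb // mxE; apply: eq_bigr => i _; rewrite mxE.
have kerG (u : 'rV_dX) : u *m G = 0 -> u *m Phi = 0.
  move=> uG; rewrite [u *m Phi]mx11_scalar -phiE.
  have -> : comb eX u = 0.
    apply: inj_g; rewrite gE uG linear0 /comb big1 // => k _.
    by rewrite mxE algZ0.
  have := phiL (-1) 0 0; rewrite scaler0 addr0 mulN1r addNr => ->;
    apply: raddf0.
exists (fun y => (coord y *m (pinvmx G *m Phi)) 0 0) => [c x y|x].
  by rewrite coordL mulmxDl -scalemxAl !mxE.
have [u /eqP->] := spanX x; rewrite gE phiE.
have -> : coord (comb e (u *m G)) = u *m G.
  by apply: (lin_indep_inj indep_e); rewrite coordK.
apply/eqP; rewrite -subr_eq0.
have -> : (u *m G *m (pinvmx G *m Phi)) 0 0 - (u *m Phi) 0 0 =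
   ((u *m G *m pinvmx G - u) *m Phi) 0 0.
  by rewrite mulmxBl !mulmxA [RHS]mxE [X in _ = _ + X]mxE.
by rewrite kerG ?mxE // mulmxBl mulmxKpV ?submxMl // subrr.
Qed.

(** * Exact sequences with projective terms *)

Section DirectSum.
Variables (K : fieldType) (A : algType K) (X Y : fdmod A).

Lemma pair_fin_dim : fin_dim ((X * Y)%type : lmodType A).
Proof.
have [dX [eX spanX]] := fdmodP X; have [dY [eY spanY]] := fdmodP Y.
apply: (@fin_dim_fin K A _ ('I_dX + 'I_dY)%type
  (fun t => match t with inl i => (eX i, 0) | inr j => (0, eY j) end)).
case=> x y; have [c ex] := spanX x; have [c' ey] := spanY y.
exists (fun t => match t with inl i => c i | inr j => c' j end).
rewrite big_sumType /= ex ey.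
rewrite [X in X + _](_ : _ = (\sum_i (c i)%:A *: eX i, 0)); last first.
  by elim/big_rec2: _ => // i v u _ ->; congr (_, _); rewrite addr0;
    apply: scaler0.
rewrite [X in _ + X](_ : _ = (0, \sum_i (c' i)%:A *: eY i)).
  by congr (_, _); rewrite ?addr0 ?add0r.
by elim/big_rec2: _ => // i v u _ ->; congr (_, _); rewrite addr0;
  apply: scaler0.
Qed.

Definition dsum : fdmod A := FdMod pair_fin_dim.

End DirectSum.

(** Von Neumann regularity: f is split onto its image. *)
Definition regular_map (K : fieldType) (A : algType K) (X Y : lmodType A)
    (f : {linear X -> Y}) : Prop :=
  exists s : {linear Y -> X}, forall x, f (s (f x)) = f x.

(** The projection p = 1 - s g of Y has image ker g = im f, so it factors
    through f when Y is projective, and then f is regular. To avoid the module ker g,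
    the identity of Y is lifted instead along the surjection
    (x, y) |-> f x + s (g y) from X * Y, whose second summand has image in the
    kernel of p. *)
Lemma regular_pred (K : fieldType) (A : algType K) (X Y Z : fdmod A)
    (f : {linear X -> Y}) (g : {linear Y -> Z}) :
  projective_mod Y -> exact_at f g -> regular_map g -> regular_map f.
Proof.
move=> projY exfg [s gsg].
pose h0 (xy : X * Y) : Y := f xy.1 + s (g xy.2).
have h0L : linear h0.
  move=> a [x y] [x' y'] /=; rewrite /h0 /=.
  by rewrite !linearP scalerDr addrACA.
pose h0m := GRing.isLinear.Build A (X * Y)%type Y *:%R h0 h0L.
pose h : {linear dsum X Y -> Y} := HB.pack h0 h0m.
have h_surj y : exists xy, h xy = y.
  have [|x fx] := (exfg (y - s (g y))).1.
    by rewrite linearB /= gsg subrr.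
  by exists (x, y); rewrite /= /h0 /= fx subrK.
have [r hr] := projY _ _ h [the {linear Y -> Y} of idfun] h_surj.
pose p0 y := (r y).1.
have p0L : linear p0 by move=> a x y; rewrite /p0 linearP.
pose p0m := GRing.isLinear.Build A Y X *:%R p0 p0L.
exists (HB.pack_for {linear Y -> X} p0 p0m) => x /=.
have e := hr (f x); rewrite /= /h0 in e.
have g0 : g (f x) = 0 by apply/exfg; exists x.
have gr : g (s (g (r (f x)).2)) = 0.
  have gf0 : g (f (r (f x)).1) = 0 by apply/exfg; exists (r (f x)).1.
  by have := congr1 g e; rewrite linearD gf0 add0r g0.
by rewrite -{2}e /p0 -[g (r (f x)).2]gsg gr linear0 addr0.
Qed.

(** * Path bases of bound quiver algebras *)

(** What is used of a bound quiver algebra with zero relations: a basis of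
    nonzero paths with the multiplication of paths. Column s and row t of the
    coefficient matrix of a belong to the path from s to t, so that coefficient
    matrices multiply like elements of A up to entries at zero paths. *)
Record path_basis (K : fieldType) (n : nat) (A : algType K) := PathBasis {
  nz :> path_pred n;
  coef : A -> 'M[K]_n;
  pth : 'I_n -> 'I_n -> A;
  coef_is_linear : linear coef;
  coef_pth : forall s t : 'I_n,
    coef (pth s t) = if nz s t then delta_mx t s else 0;
  coef_expand : forall a, a = \sum_s \sum_t coef a t s *: pth s t;
  pth0 : forall s t : 'I_n, ~~ nz s t -> pth s t = 0;
  pth_comp : forall s t u : 'I_n,
    (s <= t)%N -> (t <= u)%N -> pth t u * pth s t = pth s u;
  pth_ortho : forall s t t' u : 'I_n, t != t' -> pth t' u * pth s t = 0;
  pth_one : 1 = \sum_s pth s s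
}.

Section PathBasisTheory.
Variables (K : fieldType) (n : nat) (A : algType K) (B : path_basis n A).
Local Notation coef := (coef B).
Local Notation pth := (pth B).
Local Notation nz := (nz B).
Implicit Types (a b : A) (i j k m s t u : 'I_n).

HB.instance Definition _ := GRing.isLinear.Build K A 'M[K]_n *:%R coef
  (coef_is_linear B).

Lemma coef_linear_sum s (c : 'I_n -> K) i j :
  coef (\sum_t c t *: pth s t) i j = ((j == s) && nz s i)%:R * c i.
Proof.
rewrite raddf_sum summxE (bigD1 i) //= big1 => [|t /negPf nti].
  rewrite linearZ /= coef_pth addr0 !mxE; case: (nz s i).
    by rewrite mxE eqxx /= andbT mulrC.
  by rewrite mxE andbF mulr0 mul0r.
rewrite linearZ /= coef_pth !mxE; case: (nz s t); last by rewrite mxE mulr0.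
by rewrite mxE eq_sym nti mulr0.
Qed.

Lemma coef0 a s t : ~~ nz s t -> coef a t s = 0.
Proof.
move=> nst; rewrite [a](coef_expand B) raddf_sum summxE big1 // => s' _.
rewrite coef_linear_sum; case: eqP => [<-|]; last by rewrite mul0r.
by rewrite (negPf nst) mul0r.
Qed.

Lemma coef_lt0 a s t : (t < s)%N -> coef a t s = 0.
Proof.
move=> lt_ts; apply/coef0/negP=> /nz_le; by rewrite leqNgt lt_ts.
Qed.

Lemma mul_pth a s k : (s <= k)%N ->
  a * pth s k = \sum_t coef a t k *: pth s t.
Proof.
move=> le_sk; rewrite {1}[a](coef_expand B) mulr_suml (bigD1 k) //=.
rewrite [X in _ + X]big1 ?addr0 => [|k' nk].
  rewrite mulr_suml; apply: eq_bigr => t _; rewrite -scalerAl.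
  have [nzkt|nkt] := boolP (nz k t); first by rewrite pth_comp // (nz_le nzkt).
  by rewrite coef0 // !scale0r.
rewrite mulr_suml big1 // => t _.
by rewrite -scalerAl pth_ortho ?scaler0 // eq_sym.
Qed.

Lemma pth_mul a k m : (k <= m)%N ->
  pth k m * a = \sum_s coef a k s *: pth s m.
Proof.
move=> le_km; rewrite {1}[a](coef_expand B) mulr_sumr.
apply: eq_bigr => s _; rewrite mulr_sumr (bigD1 k) //=.
rewrite [X in _ + X]big1 ?addr0 => [|t nt]; last first.
  by rewrite -scalerAr pth_ortho ?scaler0.
rewrite -scalerAr; have [nzsk|nsk] := boolP (nz s k).
  by rewrite pth_comp // (nz_le nzsk).
by rewrite coef0 // !scale0r.
Qed.

(** The product of coefficient matrices may have entries at zero paths, where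
    the product in A has none. When t < s both sides vanish, hence the form of the
    condition. *)
Lemma coefM a b s t : ((s <= t)%N -> nz s t) ->
  coef (a * b) t s = \sum_k coef a t k * coef b k s.
Proof.
move=> nzst; rewrite [b in LHS](coef_expand B) mulr_sumr raddf_sum summxE.
have E s' : coef (a * \sum_k coef b k s' *: pth s' k) t s =
    \sum_k coef b k s' * (((s == s') && nz s' t)%:R * coef a t k).
  rewrite mulr_sumr linear_sum summxE; apply: eq_bigr => k _ /=.
  rewrite -scalerAr linearZ mxE /=.
  have [le_sk|lt_ks] := leqP s' k; last by rewrite coef_lt0 ?mul0r.
  by rewrite mul_pth // coef_linear_sum.
rewrite (bigD1 s) //= E [X in _ + X]big1 ?addr0 => [|s' /negPf ns]; last first.
  by rewrite E eq_sym ns big1 // => k _; rewrite mul0r mulr0.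
apply: eq_bigr => k _; rewrite eqxx /=.
have [le_st|lt_ts] := leqP s t; first by rewrite nzst // mul1r mulrC.
have [le_sk|lt_ks] := leqP s k; last by rewrite coef_lt0 ?mul0r ?mulr0.
by rewrite [coef a t k]coef_lt0 ?mulr0 ?mul0r // (leq_trans lt_ts).
Qed.

Lemma coef1 : coef 1 = 1%:M.
Proof.
apply/matrixP=> i j; rewrite (pth_one B) raddf_sum summxE !mxE (bigD1 j) //=.
rewrite big1 ?addr0 => [|k /negPf nk]; rewrite coef_pth nz_vertex // mxE.
  by rewrite eqxx andbT.
by rewrite [j == k]eq_sym nk andbF.
Qed.

Lemma coef_scalar (c : K) : coef c%:A = c%:M.
Proof. by rewrite linearZ /= coef1 scalemx1. Qed.

Lemma regular_fin_dim : fin_dim (A^o : lmodType A).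
Proof.
apply: (@fin_dim_fin K A (A^o :
  lmodType A) ('I_n * 'I_n)%type (fun st => pth st.1 st.2)) => a.
exists (fun st => coef a st.2 st.1); rewrite {1}[a](coef_expand B) pair_big /=.
by apply: eq_bigr => st _; rewrite -[RHS]/(_%:A * _) mulr_algl.
Qed.

End PathBasisTheory.

Section QuotientBasis.
Variables (K : fieldType) (n : nat) (rho : {set qpath n}).
Hypothesis rho_long : forall p, p \in rho -> (2 <= path_length p)%N.
Variables (I : path_algebra K n -> Prop).
Hypothesis I_gen : forall x, I x <->
  ideal_generated (fun y => exists2 p, p \in rho & y = path_elt K p) x.
Variables (A : algType K) (pi : path_algebra K n -> A).
Hypothesis piQ : is_quotient_algebra I pi.
Implicit Types (x y : path_algebra K n).

(** A path is zero in the quotient when it contains a relation. *)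
Definition quotient_nz : rel nat := fun s t => [&& (s <= t)%N, (t < n)%N &
  [forall (p : qpath n | p \in rho),
    ~~ ((s <= source p)%N && (target p <= t)%N)]].

Lemma quotient_nz_short (s t : nat) :
  (s <= t)%N -> (t < n)%N -> (t <= s.+1)%N ->
  quotient_nz s t.
Proof.
move=> le_st lt_tn le_ts; rewrite /quotient_nz le_st lt_tn /=.
apply/forall_inP=> p /rho_long; rewrite /path_length; lia.
Qed.

Fact quotient_nz_sub (s s' t' t : nat) : quotient_nz s t ->
  (s <= s')%N -> (s' <= t')%N -> (t' <= t)%N -> quotient_nz s' t'.
Proof.
case/and3P=> le_st lt_tn /forall_inP no_rho le_s le_st' le_t.
rewrite /quotient_nz le_st' (leq_ltn_trans le_t) //=.
by apply/forall_inP=> p /no_rho; lia.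
Qed.

Definition quotient_path_pred : path_pred n.
Proof.
apply: (@PathPred n quotient_nz) => [s t /and3P[]||s s' t' t|s lt_s|s lt_s] //.
- by move=> s t /and3P[].
- exact: quotient_nz_sub.
- by apply: quotient_nz_short.
- by apply: quotient_nz_short => //; apply: leqnSn.
Defined.

Local Notation mx := (@path_algebra_mx K n).

Definition path_elt_between (s t : 'I_n) : path_algebra K n :=
  [ffun p : qpath n => ((source p == s) && (target p == t))%:R].

Lemma path_elt_between_mx (s t : 'I_n) :
  mx (path_elt_between s t) = if (s <= t)%N then delta_mx t s else 0.
Proof.
apply/matrixP=> i j; rewrite mxE; case: insubP => [p /= _ vp|/= nle].
  rewrite ffunE /source /target [val p]vp /=.
  case: ifP => [_|/negP nle]; rewrite !mxE; first by rewrite andbC.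
  case: eqP => // es; case: eqP => // et; case: nle.
  by rewrite -es -et; have := valP p; rewrite [val p]vp.
case: ifP => [le_st|]; rewrite !mxE //.
by case: eqP => // ei; case: eqP => // ej; case/negP: nle; rewrite ei ej.
Qed.

Lemma path_elt_mx (p : qpath n) : mx (path_elt K p) =
  delta_mx (target p) (source p).
Proof.
have -> : path_elt K p = path_elt_between (source p) (target p).
  apply/ffunP=> q; rewrite !ffunE; congr ((nat_of_bool _)%:R).
by rewrite path_elt_between_mx; have := valP p; rewrite /target /source => ->.
Qed.

Lemma path_algebra_mxZ (c : K) x : mx (c *: x) = c *: mx x.
Proof.
apply/matrixP=> i j; rewrite !mxE.
by case: insub => [p|]; rewrite ?ffunE ?mulr0.
Qed.

Lemma path_algebra_mx_sum (J : finType) (F : J -> path_algebra K n) :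
  mx (\sum_j F j) = \sum_j mx (F j).
Proof.
apply: (big_morph mx (@path_algebra_mxD K n)).
by apply: (addrI (mx 0)); rewrite -path_algebra_mxD !addr0.
Qed.

Lemma path_algebra_expand x : x =
  \sum_s \sum_t mx x t s *: path_elt_between s t.
Proof.
apply: (@path_algebra_mx_inj K n); rewrite path_algebra_mx_sum.
rewrite [LHS]matrix_sum_delta exchange_big /=; apply: eq_bigr => s _.
rewrite path_algebra_mx_sum; apply: eq_bigr => t _.
rewrite path_algebra_mxZ path_elt_between_mx.
by case: leqP => // lt_ts; rewrite path_algebra_mx_gt // !scale0r.
Qed.

(** The elements whose coefficients at nonzero paths vanish form an ideal, since
    nonzero paths are closed under subpaths, and it contains the relations. This
    makes nonzero paths linearly independent in the quotient. *)
Lemma ideal_coef0 x (s t : 'I_n) : I x -> quotient_nz s t -> mx x t s = 0.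
Proof.
move/I_gen=> /(_ (fun x => forall s t : 'I_n, quotient_nz s t -> mx x t s = 0)).
apply=> [|_ [p rho_p ->] {}s {}t /and3P[_ _ /forall_inP/(_ p rho_p)]];
  last first.
  rewrite path_elt_mx mxE; case: eqP => // ->; case: eqP => // ->.
  by rewrite !leqnn.
have mxE0 a b s' t' : mx (a * b) t' s' = \sum_k mx a t' k * mx b k s'.
  by rewrite -[mx _]/(mx (path_algebra_mul a b)) path_algebra_mxM mxE.
split=> [s' t' _|y z y0 z0 s' t' nzst|a y y0].
- by rewrite mxE; case: insub => // p; rewrite ffunE.
- by rewrite path_algebra_mxD mxE y0 // z0 // addr0.
split=> s' t' nzst; rewrite mxE0 big1 // => k _.
  have [le_sk|lt_ks] := leqP s' k;
    last by rewrite [X in _ * X]path_algebra_mx_gt ?mulr0.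
  have [le_kt|lt_tk] := leqP k t'; last by rewrite path_algebra_mx_gt ?mul0r.
  by rewrite y0 ?mulr0 //; apply: quotient_nz_sub nzst _ _ _.
have [le_sk|lt_ks] := leqP s' k;
  last by rewrite [X in _ * X]path_algebra_mx_gt ?mulr0.
have [le_kt|lt_tk] := leqP k t'; last by rewrite path_algebra_mx_gt ?mul0r.
by rewrite y0 ?mul0r //; apply: quotient_nz_sub nzst _ _ _.
Qed.

Let pi_linear : linear pi. Proof. by case: piQ. Qed.
HB.instance Definition _ := GRing.isLinear.Build K (path_algebra K n) A *:%R pi
  pi_linear.

Let piM x y : pi (x * y) = pi x * pi y.
Proof. by case: piQ => _ [_ +] _ _; apply. Qed.

Let pi_surj a : exists x, pi x == a.
Proof. by case: piQ => _ _ /(_ a)[x <-] _; exists x. Qed.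

Definition lift_quotient a : path_algebra K n := xchoose (pi_surj a).

Lemma lift_quotientK a : pi (lift_quotient a) = a.
Proof. exact/eqP/(xchooseP (pi_surj a)). Qed.

Definition quotient_pth (s t : 'I_n) : A := pi (path_elt_between s t).

Definition quotient_coef a : 'M[K]_n := \matrix_(t, s)
  if quotient_nz s t then mx (lift_quotient a) t s else 0.

Lemma quotient_coef_pi x (s t : 'I_n) :
  quotient_coef (pi x) t s = if quotient_nz s t then mx x t s else 0.
Proof.
rewrite mxE; case: ifP => // nzst; apply/eqP; rewrite -subr_eq0.
have -> : mx (lift_quotient (pi x)) t s - mx x t s =
    mx (lift_quotient (pi x) - x) t s.
  by rewrite -scaleN1r path_algebra_mxD path_algebra_mxZ scaleN1r !mxE.
apply/eqP/ideal_coef0 => //; case: piQ => _ _ _ kerpi; apply/kerpi.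
by rewrite linearB /= lift_quotientK subrr.
Qed.

(** A path containing a relation p is a product with p as a factor. *)
Lemma quotient_pth0 (s t : 'I_n) : ~~ quotient_nz s t -> quotient_pth s t = 0.
Proof.
have [le_st|lt_ts] := leqP s t => nst; last first.
  rewrite /quotient_pth -(linear0 pi); congr (pi _).
  apply: (@path_algebra_mx_inj K n); rewrite path_elt_between_mx leqNgt lt_ts.
  by apply/matrixP=> i j; rewrite !mxE; case: insub => // p; rewrite ffunE.
have [p rho_p /andP[le_sp le_pt]] :
    exists2 p : qpath n, p \in rho & (s <= source p)%N && (target p <= t)%N.
  move: nst; rewrite /quotient_nz le_st ltn_ord /= negb_forall_in.
  by case/exists_inP=> p rp; rewrite negbK; exists p.
rewrite /quotient_pth.
have -> : path_elt_between s t = path_elt_between (target p) t *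
    path_elt K p * path_elt_between s (source p).
  apply: (@path_algebra_mx_inj K n).
  rewrite -[_ * _]/(path_algebra_mul (path_algebra_mul _ _) _).
  rewrite !path_algebra_mxM path_elt_mx !path_elt_between_mx le_sp le_pt le_st.
  by rewrite !mul_delta_mx.
rewrite !piM [X in _ * X * _](_ : _ = 0) ?mulr0 ?mul0r //.
case: piQ => _ _ _ kerpi; apply/kerpi/I_gen => J _; apply.
by exists p.
Qed.

Lemma quotient_coef_expand a :
  a = \sum_s \sum_t quotient_coef a t s *: quotient_pth s t.
Proof.
rewrite -{1}(lift_quotientK a) {1}(path_algebra_expand (lift_quotient a)).
rewrite linear_sum.
apply: eq_bigr => s _; rewrite linear_sum; apply: eq_bigr => t _.
rewrite linearZ /= [quotient_coef _ _ _]mxE; case: ifP => // /negbT nst.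
by rewrite scale0r [X in _ *: X](quotient_pth0 nst) scaler0.
Qed.

Definition quotient_basis : path_basis n A.
Proof.
apply: (@PathBasis K n A quotient_path_pred quotient_coef quotient_pth).
- move=> c a b; rewrite -(lift_quotientK a) -(lift_quotientK b) -linearP.
  apply/matrixP=> t s; rewrite [RHS]mxE [X in _ = X + _]mxE !quotient_coef_pi.
  rewrite path_algebra_mxD path_algebra_mxZ.
  by case: ifP => _; rewrite ?mulr0 ?addr0 // [LHS]mxE [X in X + _ = _]mxE.
- move=> s t; apply/matrixP=> i j; rewrite quotient_coef_pi path_elt_between_mx /=.
  case: (boolP (quotient_nz s t)) => [nzst|nst].
    rewrite (_ : (s <= t)%N) ?mxE; last by case/andP: nzst.
    case: eqP => [->|_]; last by rewrite if_same.
    by case: eqP => [->|_]; rewrite ?nzst ?if_same.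
  rewrite [RHS]mxE; case: ifP => // nzji; case: ifP => _; rewrite mxE //.
  by case: eqP => // ei; case: eqP => // ej; case/negP: nst; rewrite -ei -ej.
- exact: quotient_coef_expand.
- exact: quotient_pth0.
- move=> s t u le_st le_tu; rewrite /quotient_pth -piM; congr (pi _).
  apply: (@path_algebra_mx_inj K n).
  rewrite -[_ * _]/(path_algebra_mul _ _) path_algebra_mxM !path_elt_between_mx.
  by rewrite le_st le_tu (leq_trans le_st) // mul_delta_mx.
- move=> s t t' u nt; rewrite /quotient_pth -piM -(linear0 pi); congr (pi _).
  apply: (@path_algebra_mx_inj K n).
  rewrite -[_ * _]/(path_algebra_mul _ _) path_algebra_mxM !path_elt_between_mx.
  have -> : mx 0 = 0.
    by apply/matrixP=> i j; rewrite !mxE; case: insub => // p; rewrite ffunE.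
  do 2![case: ifP => _; rewrite ?mulmx0 ?mul0mx //].
  by rewrite mul_delta_mx_0 // eq_sym.
- case: piQ => _ [pi1 _] _ _; rewrite -pi1 -linear_sum; congr (pi _).
  apply: (@path_algebra_mx_inj K n); rewrite path_algebra_mx_sum.
  rewrite [LHS]path_algebra_mx1; apply/matrixP=> i j; rewrite summxE !mxE.
  rewrite (bigD1 j) //= big1 ?addr0 => [|k /negPf nk].
    by rewrite path_elt_between_mx leqnn !mxE eqxx andbT.
  by rewrite path_elt_between_mx leqnn !mxE [j == k]eq_sym nk andbF.
Defined.

End QuotientBasis.

(** * Interval modules *)

(** The supports of a family of n interval modules, one for each row. *)
Record shape (K : fieldType) (n : nat) (A : algType K) (B : path_basis n A) :=
  Shape {
    row_of :> 'I_n -> pred nat;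
    row_interval : forall i, is_interval B (row_of i)
  }.

Section IntervalModule.
Variables (K : fieldType) (n : nat) (A : algType K) (B : path_basis n A).
Variable S : shape B.
Local Notation coef := (coef B).
Implicit Types (a b : A) (m : 'M[K]_n) (i j k s t : 'I_n).

Definition supported m : bool :=
  [forall i : 'I_n, forall j : 'I_n, S i j || (m i j == 0)].

Lemma supportedP m :
  reflect (forall i j, ~~ S i j -> m i j = 0) (supported m).
Proof.
apply: (iffP forallP) => [sm i j nS|sm i].
  by have /forallP/(_ j) := sm i; rewrite (negPf nS) => /eqP.
by apply/forallP=> j; case: (boolP (S i j)) => //= /sm->.
Qed.

Fact supported_zmod_closed : zmod_closed supported.
Proof.
split=> [|m m' /supportedP sm /supportedP sm']; apply/supportedP=> i j nS.
  by rewrite mxE.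
by rewrite !mxE sm // sm' // subrr.
Qed.
HB.instance Definition _ :=
  GRing.isZmodClosed.Build 'M[K]_n supported supported_zmod_closed.

(** The direct sum over i of the modules carried by row i of S, with coordinates
    stored as a matrix so that all of them share one ambient type. *)
Definition interval_mod : predArgType := {m : 'M[K]_n | supported m}.
HB.instance Definition _ := [isSub of interval_mod for (@sval _ supported)].
HB.instance Definition _ := [Choice of interval_mod by <:].
HB.instance Definition _ := [SubChoice_isSubZmodule of interval_mod by <:].
Implicit Types u v : interval_mod.

(** Kept from unfolding, so that simplification does not expose the matrices
    behind the module operations. *)
Definition entry v i j : K := val v i j.
Arguments entry : simpl never.

Lemma entry_inj u v : (forall i j, entry u i j = entry v i j) -> u = v.
Proof. by move=> uv; apply/val_inj/matrixP. Qed.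

Lemma entry0 v i j : ~~ S i j -> entry v i j = 0.
Proof. by move=> nS; exact: (supportedP _ (valP v)). Qed.

Definition mask m : 'M[K]_n := \matrix_(i, j) if S i j then m i j else 0.

Fact mask_supported m : supported (mask m).
Proof. by apply/supportedP=> i j /negPf nS; rewrite mxE nS. Qed.

Definition restrict m : interval_mod := exist _ (mask m) (mask_supported m).

Lemma restrictE m i j : entry (restrict m) i j = if S i j then m i j else 0.
Proof. by rewrite /entry mxE. Qed.

Lemma restrict_val v : restrict (val v) = v.
Proof.
apply: entry_inj => i j; rewrite restrictE.
by case: ifP => // /negbT nS; rewrite entry0.
Qed.

Definition act a v := restrict (val v *m (coef a)^T).

Lemma actE a v i t : entry (act a v) i t =
  if S i t then \sum_s entry v i s * coef a t s else 0.
Proof.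
rewrite restrictE !mxE; case: ifP => // _.
by apply: eq_bigr => s _; rewrite mxE.
Qed.

(** Cutting off after each factor loses nothing: a vertex between two vertices
    of row i lies in row i. *)
Fact actA a b v : act a (act b v) = act (a * b) v.
Proof.
apply: entry_inj => i t; rewrite !actE; case: ifP => // Sit.
transitivity (\sum_k \sum_s entry v i s * (coef a t k * coef b k s)).
  apply: eq_bigr => k _; rewrite actE; case: ifP => [Sik|/negbT nSik].
    by rewrite mulr_suml; apply: eq_bigr => s _;
      rewrite -mulrA [X in _ * X]mulrC.
  rewrite mul0r big1 // => s _.
  have [Sis|nSis] := boolP (S i s); last by rewrite entry0 ?mul0r.
  have [le_sk|lt_ks] := leqP s k; last by rewrite [coef b k s]coef_lt0 ?mulr0.
  have [le_kt|lt_tk] := leqP k t;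
    last by rewrite [coef a t k]coef_lt0 ?mul0r ?mulr0.
  by case/negP: nSik; apply: (row_interval S i).2 Sis Sit _; rewrite le_sk.
rewrite exchange_big; apply: eq_bigr => s _ /=; rewrite -mulr_sumr.
have [Sis|nSis] := boolP (S i s); last by rewrite entry0 ?mul0r.
by rewrite coefM // => le_st; apply: (row_interval S i).1.
Qed.

Fact act1 : left_id 1 act.
Proof. by move=> v; rewrite /act coef1 trmx1 mulmx1 restrict_val. Qed.

Lemma valD u v : val (u + v) = val u + val v. Proof. exact: raddfD. Qed.

Fact restrictD m m' : restrict (m + m') = restrict m + restrict m'.
Proof.
apply: val_inj; rewrite valD; apply/matrixP=> i j; rewrite !mxE.
by case: ifP; rewrite ?addr0.
Qed.

Fact actDr : right_distributive act +%R.
Proof. by move=> a u v; rewrite /act valD mulmxDl restrictD. Qed.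

Fact actDl v : {morph act^~ v : a b / a + b}.
Proof. by move=> a b; rewrite /act -restrictD -mulmxDr -linearD -raddfD. Qed.

HB.instance Definition _ :=
  GRing.Zmodule_isLmodule.Build A interval_mod actA act1 actDr actDl.

Lemma scaleE a v i t : entry (a *: v) i t =
  if S i t then \sum_s entry v i s * coef a t s else 0.
Proof. exact: actE. Qed.

Lemma entryD u v i j : entry (u + v) i j = entry u i j + entry v i j.
Proof. by rewrite /entry valD mxE. Qed.

Lemma algZE (c : K) v i j : entry (c%:A *: v) i j = c * entry v i j.
Proof.
rewrite scaleE coef_scalar; case: ifP => [_|/negbT nS]; last first.
  by rewrite entry0 ?mulr0.
rewrite (bigD1 j) //= big1 => [|s /negPf ns];
  first by rewrite addr0 mxE eqxx mulrC.
by rewrite mxE eq_sym ns mulr0.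
Qed.

Lemma pthE s t v i j : entry (pth B s t *: v) i j =
  if [&& S i j, j == t & B s t] then entry v i s else 0.
Proof.
rewrite scaleE coef_pth; case: ifP => //= _; case: (nz B s t) => /=; last first.
  by rewrite andbF big1 // => k _; rewrite mxE mulr0.
rewrite andbT (bigD1 s) //= big1 => [|k /negPf nk]; last first.
  by rewrite mxE nk andbF mulr0.
by rewrite addr0 mxE eqxx andbT; case: eqP; rewrite ?mulr1 ?mulr0.
Qed.

Lemma entry_sum (J : finType) (F : J -> interval_mod) i j :
  entry (\sum_k F k) i j = \sum_k entry (F k) i j.
Proof. by rewrite /entry raddf_sum summxE. Qed.

Definition unit_vec (ij : 'I_n * 'I_n) := restrict (delta_mx ij.1 ij.2).

Lemma interval_fin_dim : fin_dim (interval_mod : lmodType A).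
Proof.
apply: (@fin_dim_fin K A _ ('I_n * 'I_n)%type unit_vec) => v.
exists (fun ij => entry v ij.1 ij.2); apply: entry_inj => i j.
rewrite entry_sum (bigD1 (i, j)) // big1 => [|[k l] nkl].
  rewrite [RHS]addr0 algZE restrictE mxE /= !eqxx.
  by case: ifP => [_|/negbT nS]; rewrite ?mulr1 // entry0 ?mul0r.
rewrite algZE restrictE mxE; case: ifP => _; last by rewrite mulr0.
case: eqP nkl => [[-> ->]|ne _] /=; first by [].
by case: eqP ne => [->|]; case: eqP => [->|]; rewrite /= ?mulr0.
Qed.

Definition interval_fdmod : fdmod A := FdMod interval_fin_dim.

(** If row i consists of all vertices with a nonzero path to m, its module is
    dual to the projective right module at m: a map f into it is determined by
    the functional that takes x to entry (i, m) of f x, because entry (i, j) of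
    f x is the value of this functional at the path from j to m times x.
    Extending the functionals extends the map. *)
Lemma interval_injective :
  (forall i, (exists2 m : 'I_n, S i m & S i =1 (nz B)^~ m) \/ S i =1 xpred0) ->
  injective_mod interval_fdmod.
Proof.
move=> rowS X Y g f inj_g.
(* an empty row imposes no condition, so any vertex serves as its socle *)
have /fin_all_exists[soc socP] i : exists m : 'I_n, forall j, S i j ->
    S i m /\ S i =1 (nz B)^~ m.
  by case: (rowS i) => [[m Sm eS]|eS]; [exists m | exists i => j; rewrite eS].
have /fin_all_exists2[psi psiL psiE] i : exists2 psi : Y -> K, functional psi &
    forall x, psi (g x) = entry (f x) i (soc i).
  by apply: functional_extension => // c x y; rewrite linearP entryD algZE.
pose h y : interval_fdmod :=
  restrict (\matrix_(i, j) psi i (pth B j (soc i) *: y)).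
have hE y i j : entry (h y) i j =
    if S i j then psi i (pth B j (soc i) *: y) else 0.
  by rewrite restrictE mxE.
have hL : linear h.
  move=> a x y; apply: entry_inj => i t.
  rewrite entryD scaleE !hE; case: ifP => [Sit|_]; last by rewrite addr0.
  have [Ssoc eS] := socP i t Sit.
  have psiD (u v : Y) : psi i (u + v) = psi i u + psi i v.
    by rewrite -[u]algZ1 (psiL i) mul1r algZ1.
  have psi0 : psi i 0 = 0.
    have /eqP := psiL i 1 0 0; rewrite scaler0 addr0 mul1r.
    by rewrite -subr_eq0 opprD addNKr oppr_eq0 => /eqP.
  rewrite scalerDr psiD; congr (_ + _).
  rewrite scalerA pth_mul; last by rewrite eS in Sit; apply: nz_le Sit.
  rewrite scaler_suml (big_morph (psi i) psiD psi0).
  apply: eq_bigr => s _;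
    rewrite hE algZ -[_ *: _]addr0 (psiL i) psi0 addr0 mulrC.
  case: ifP => [Sis // | /negbT]; rewrite eS => nSis.
  by rewrite pth0 // scale0r psi0 !mul0r.
pose hm := GRing.isLinear.Build A Y interval_fdmod *:%R h hL.
exists (HB.pack_for {linear Y -> interval_fdmod} h hm) => x.
apply: entry_inj => i j; rewrite hE.
case: ifP => [Sij|/negbT nS]; last by rewrite entry0.
have [Ssoc eS] := socP i j Sij.
by rewrite -linearZ psiE linearZ pthE Ssoc eqxx -eS Sij.
Qed.

(** If row i consists of all vertices reached from a, its module is the
    left ideal generated by the idempotent at a, and a lift is determined by a
    preimage of the image of that generator. *)
Lemma interval_projective :
  (forall i, exists a : 'I_n, S i =1 nz B a) -> projective_mod interval_fdmod.
Proof.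
move=> rowS X Y g f g_surj.
have [top topP] := fin_all_exists rowS.
have /fin_all_exists[x gx] i : exists x, g x = f (unit_vec (i, top i)).
  exact: g_surj.
pose h (v : interval_fdmod) : X :=
  \sum_i \sum_j (entry v i j)%:A *: (pth B (top i) j *: x i).
have hL : linear h.
  move=> a u v; rewrite /h scaler_sumr -big_split; apply: eq_bigr => i _ /=.
  transitivity (\sum_t ((entry (a *: u) i t)%:A *:
     (pth B (top i) t *: x i)) + \sum_t (entry v i t)%:A *:
     (pth B (top i) t *: x i)).
    by rewrite -big_split; apply: eq_bigr => t _; rewrite entryD algZDl.
  congr (_ + _).
  transitivity (\sum_t \sum_s (entry u i s * coef a t s)%:A *:
     (pth B (top i) t *: x i)).
    apply: eq_bigr => t _; rewrite scaleE; case: ifP => [_|/negbT].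
      by rewrite !scaler_suml.
    rewrite topP => nS; rewrite pth0 // !scale0r big1 // => s _.
    by rewrite scaler0.
  rewrite exchange_big scaler_sumr; apply: eq_bigr => s _ /=.
  have [Sis|nSis] := boolP (S i s); last first.
    rewrite entry0 // algZ0 scaler0 big1 // => t _.
    by rewrite mul0r algZ0.
  rewrite -algZC scalerA mul_pth; last by rewrite topP in Sis; apply: nz_le Sis.
  rewrite scaler_suml scaler_sumr; apply: eq_bigr => t _.
  by rewrite [X in _ = _ *: X]algZ algZA.
pose hm := GRing.isLinear.Build A interval_fdmod X *:%R h hL.
exists (HB.pack_for {linear interval_fdmod -> X} h hm) => v.
rewrite -[LHS]/(g (h v)) /h linear_sum.
transitivity (f (\sum_i \sum_j (entry v i j)%:A *:
    (pth B (top i) j *: unit_vec (i, top i)))).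
  rewrite linear_sum; apply: eq_bigr => i _; rewrite !linear_sum.
  by apply: eq_bigr => j _; rewrite !linearZ gx.
congr (f _); apply: entry_inj => i j.
have row_sum k : entry (\sum_l (entry v k l)%:A *:
    (pth B (top k) l *: unit_vec (k, top k))) i j =
    if k == i then entry v i j else 0.
  rewrite entry_sum; case: eqP => [->|/eqP nk]; last first.
    rewrite big1 // => l _; rewrite algZE pthE restrictE mxE.
    by rewrite [i == _]eq_sym (negPf nk) !if_same mulr0.
  rewrite (bigD1 j) // big1 => [|l nl]; last first.
    by rewrite algZE pthE eq_sym (negPf nl) andbF mulr0.
  rewrite [LHS]addr0 algZE pthE eqxx restrictE mxE !eqxx -topP.
  case: (boolP (S i j)) => [_|nS]; last by rewrite entry0 ?mul0r.
  by rewrite topP nz_vertex ?mulr1.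
rewrite entry_sum (bigD1 i) // row_sum eqxx big1 => [|k nk].
  exact: addr0.
by rewrite row_sum; case: eqP nk => // ->; rewrite eqxx.
Qed.

End IntervalModule.

(** * The minimal injective resolution of the regular module *)

(** Restricting coordinates from one shape to another is linear when the common
    vertices form, in each row, a quotient of the first module (an initial part)
    and a submodule of the second (a final part). *)
Section Transfer.
Variables (K : fieldType) (n : nat) (A : algType K) (B : path_basis n A).
Variables (S S' : shape B).

Definition transfer (v : interval_mod S) : interval_mod S' :=
  restrict S' (val v).

Lemma transferE v i j :
  entry (transfer v) i j = if S' i j then entry v i j else 0.
Proof. exact: restrictE. Qed.

Hypothesis down : forall (i s t : 'I_n),
  S i s -> S i t -> S' i t -> (s <= t)%N -> S' i s.
Hypothesis up : forall (i s t : 'I_n),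
  S i s -> S' i s -> S' i t -> (s <= t)%N -> S i t.

Lemma transfer_linear : linear transfer.
Proof.
move=> a u v; apply: entry_inj => i t;
  rewrite entryD !(transferE, scaleE, entryD).
case: ifP => S't; last by rewrite addr0.
congr (_ + _).
transitivity (if S i t then \sum_s entry u i s * coef B a t s else 0) => //.
case: ifP => [Sit|/negbT nSit].
  apply: eq_bigr => s _; rewrite transferE; case: ifP => // /negbT nS's.
  have [Sis|nSis] := boolP (S i s); last by rewrite entry0.
  have [le_st|lt_ts] := leqP s t; last by rewrite coef_lt0 ?mulr0.
  by case/negP: nS's; apply: down Sis Sit S't le_st.
rewrite big1 // => s _; rewrite transferE; case: ifP => [S's|_];
  last by rewrite mul0r.
have [Sis|nSis] := boolP (S i s); last by rewrite entry0 ?mul0r.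
have [le_st|lt_ts] := leqP s t; last by rewrite coef_lt0 ?mulr0.
by case/negP: nSit; apply: up Sis S's S't le_st.
Qed.

End Transfer.

Section Resolution.
Variables (K : fieldType) (n : nat) (A : algType K) (B : path_basis n A).
Implicit Types (i j s t : 'I_n) (k : nat).

Definition cosyz_row k i : pred nat := iter k (cosyzygy B) (B i).

Lemma cosyz_row_interval k i : is_interval B (cosyz_row k i).
Proof.
elim: k => [|k IHk]; first exact: interval_arrows.
exact: cosyzygy_interval.
Qed.

Definition hull_shape k : shape B :=
  Shape (fun i => hull_interval (cosyz_row_interval k i)).

Definition res_mod k : fdmod A := interval_fdmod (hull_shape k).

Lemma res_mod_injective k : injective_mod (res_mod k).
Proof.
apply: interval_injective => i.
have iQ := cosyz_row_interval k i.
have [[m Qm eH]|eH] := hull_cases iQ; [left | by right].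
have lt_mn := interval_lt iQ Qm.
by exists (Ordinal lt_mn); [rewrite /= eH (iQ.1 m m) | exact: eH].
Qed.

Lemma res_mod0_projective : projective_mod (res_mod 0).
Proof.
apply: interval_projective => i.
have [a lt_an eH] := hull_arrows_projective B (ltn_ord i).
by exists (Ordinal lt_an).
Qed.

Lemma hull_down k i s t : hull_shape k i s -> hull_shape k i t ->
  hull_shape k.+1 i t -> (s <= t)%N -> hull_shape k.+1 i s.
Proof.
have iQ := cosyz_row_interval k i; rewrite /= => Hs Ht.
rewrite !(hull_cosyzygy iQ) // => nQt le_st; apply/negP=> Qs.
by case/negP: nQt; apply: hull_up iQ Qs Ht le_st.
Qed.

Lemma hull_up_closed k i s t : hull_shape k i s -> hull_shape k.+1 i s ->
  hull_shape k.+1 i t -> (s <= t)%N -> hull_shape k i t.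
Proof.
have iQ := cosyz_row_interval k i; have iQ' := cosyz_row_interval k.+1 i.
rewrite /= => Hs H's H't le_st.
have Qs : cosyzygy B (cosyz_row k i) s.
  by rewrite /cosyzygy Hs -(hull_cosyzygy iQ).
by have /andP[] := hull_up iQ' Qs H't le_st.
Qed.

Definition res_map k : res_mod k -> res_mod k.+1 :=
  @transfer K n A B (hull_shape k) (hull_shape k.+1).

HB.instance Definition _ k :=
  GRing.isLinear.Build A (res_mod k) (res_mod k.+1) *:%R (@res_map k)
    (transfer_linear (@hull_down k) (@hull_up_closed k)).

(** The embedding of A into its injective envelope. The transpose puts the
    summand of A generated by vertex i into row i. *)
Definition reg_map (a : A^o) : res_mod 0 :=
  restrict (hull_shape 0) (coef B a)^T.

Lemma reg_mapE a i j : entry (reg_map a) i j = coef B a j i.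
Proof.
rewrite restrictE mxE; case: ifP => // /negbT nH; rewrite coef0 //.
apply: contra nH => nzij.
exact: (sub_hull (cosyz_row_interval 0 i)).
Qed.

Fact reg_map_linear : linear reg_map.
Proof.
move=> a b c; apply: entry_inj => i t.
rewrite entryD scaleE !reg_mapE linearD mxE; congr (_ + _).
case: ifP => [Hit|/negbT nH].
  rewrite coefM => [|le_it].
    by apply: eq_bigr => s _; rewrite reg_mapE mulrC.
  exact: (hull_up (interval_arrows B i) (nz_vertex B (ltn_ord i)) Hit le_it).
rewrite coef0 //; apply: contra nH => nzit.
exact: (sub_hull (cosyz_row_interval 0 i)).
Qed.

HB.instance Definition _ :=
  GRing.isLinear.Build A A^o (res_mod 0) *:%R reg_map reg_map_linear.

Lemma reg_map_inj : injective reg_map.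
Proof.
move=> a b eab; rewrite [a](coef_expand B) [b](coef_expand B).
by apply: eq_bigr => s _; apply: eq_bigr => t _; rewrite -!reg_mapE eab.
Qed.

Definition cosyz_supported k (v : interval_mod (hull_shape k)) : Prop :=
  forall i j, ~~ cosyz_row k i j -> entry v i j = 0.

Lemma res_map_ker k (v : res_mod k) : res_map v = 0 <-> cosyz_supported v.
Proof.
have z_entry (S : shape B) i j : entry (0 : interval_mod S) i j = 0.
  by rewrite /entry raddf0 mxE.
split=> [v0 i j nQ|vQ].
  have [Hij|] := boolP (hull_shape k i j); last exact: entry0.
  rewrite -(z_entry (hull_shape k.+1) i j) -v0 transferE.
  by rewrite /= (hull_cosyzygy (cosyz_row_interval k i)) // nQ.
apply: entry_inj => i j; rewrite transferE z_entry; case: ifP => // H'ij.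
have [Hij|] := boolP (hull_shape k i j); last exact: entry0.
by apply: vQ; rewrite -(hull_cosyzygy (cosyz_row_interval k i)).
Qed.

Lemma res_map_img k (w : res_mod k.+1) :
  (exists v, res_map v = w) <-> cosyz_supported w.
Proof.
split=> [[v <-] i j nQ|wQ].
  rewrite transferE; case: ifP => // H'ij; apply: entry0;
    apply: contra nQ => Hij.
  by apply/andP; split; rewrite // -(hull_cosyzygy (cosyz_row_interval k i)).
exists (transfer (hull_shape k) w); apply: entry_inj => i j; rewrite !transferE.
have [Q'|nQ'] := boolP (cosyz_row k.+1 i j); last by rewrite wQ // !if_same.
have Hij : hull_shape k i j by case/andP: Q'.
have H'ij : hull_shape k.+1 i j by apply: sub_hull (cosyz_row_interval k.+1 i)
  Q'.
by rewrite Hij H'ij.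
Qed.

Lemma reg_map_img (w : res_mod 0) :
  (exists a, reg_map a = w) <-> cosyz_supported w.
Proof.
split=> [[a <-] i j nQ|wQ]; first by rewrite reg_mapE coef0.
exists (\sum_i \sum_j entry w i j *: pth B i j); apply: entry_inj => i j.
rewrite reg_mapE raddf_sum summxE (bigD1 i) //= coef_linear_sum eqxx /=.
rewrite big1 => [|k nk]; last first.
  by rewrite coef_linear_sum eq_sym (negPf nk) mul0r.
have [nzij|nij] := boolP (B i j); first by rewrite mul1r addr0.
by rewrite wQ // mulr0 addr0.
Qed.

(** A nonzero vector is pushed along arrows until it has an entry at a vertex t
    and all its entries at t lie in the cosyzygy; its component at t will do. An
    entry outside the cosyzygy is not at the end of its row, so one more arrow
    moves it to a later vertex without killing it. As different rows end at
    different vertices, this may have to be repeated. *)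
Lemma socle_in_submodule k (N : interval_mod (hull_shape k) -> Prop) :
  submodule N -> (exists2 v, N v & v != 0) ->
  exists w, [/\ N w, w != 0 & cosyz_supported w].
Proof.
case=> N0 Nlin [v Nv nzv].
have Nscale a u : N u -> N (a *: u) by move=> Nu; rewrite -[_ *: _]addr0;
  apply: Nlin.
have nz_entry (u : interval_mod (hull_shape k)) i t :
  entry u i t != 0 -> u != 0.
  by apply: contraNneq => ->; rewrite /entry raddf0 mxE.
have [i [t nzvit]] : exists i t, entry v i t != 0.
  apply: NNPP => no_entry; case/negP: nzv; apply/eqP/entry_inj => i t.
  rewrite [RHS]/entry raddf0 mxE; apply/eqP/negPn/negP=> nzvit.
  by apply: no_entry; exists i, t.
move: {-1}(n - t)%N (leqnn (n - t)) => b.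
elim: b v i t Nv nzvit {nzv} => [|b IHb] v i t Nv nzvit le_b.
  by have := ltn_ord t; lia.
have [[i' [nzv' nQ]]|top_t] :=
    classic (exists i', entry v i' t != 0 /\ ~~ cosyz_row k i' t).
  have iQ := cosyz_row_interval k i'.
  have Ht : hull_shape k i' t by apply: contraNT nzv' => nH; rewrite entry0.
  have [m [Qm _ nztm]] := hullP _ _ _ Ht.
  have lt_tm : (t < m)%N.
    rewrite ltn_neqAle (nz_le nztm) andbT.
    by apply: contra nQ => /eqP->.
  have lt_t1 : (t.+1 < n)%N by apply: leq_ltn_trans lt_tm (nz_lt nztm).
  have Ht1 : hull_shape k i' t.+1.
    apply: (hull_interval iQ).2 Ht (sub_hull iQ Qm) _.
    by rewrite leqnSn lt_tm.
  pose t1 := Ordinal lt_t1.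
  apply: (IHb (pth B t t1 *: v) i' t1); [exact: Nscale | | by rewrite /=; lia].
  by rewrite pthE Ht1 eqxx nz_arrow.
exists (pth B t t *: v); split; first exact: Nscale.
  apply: (nz_entry _ i t); rewrite pthE eqxx nz_vertex // andbT.
  by have -> : hull_shape k i t by apply: contraNT nzvit => nH; rewrite entry0.
move=> i' j nQ; rewrite pthE; case: ifP => // /and3P[_ /eqP ej _].
apply/eqP/negPn/negP=> nzv'; apply: top_t; exists i'; split=> //.
by rewrite -ej.
Qed.

Lemma reg_map_essential : @essential_image K A A^o (res_mod 0) reg_map.
Proof.
move=> N subN /(socle_in_submodule subN)[w [Nw nzw wQ]].
by have [a aw] := (reg_map_img w).2 wQ; exists a; rewrite aw.
Qed.

Lemma res_map_essential k : essential_image (@res_map k).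
Proof.
move=> N subN /(socle_in_submodule subN)[w [Nw nzw wQ]].
by have [v vw] := (res_map_img w).2 wQ; exists v; rewrite vw.
Qed.

Definition regular_resolution : min_inj_resolution (A^o : lmodType A).
Proof.
apply: (@MinInjResolution K A (A^o : lmodType A) res_mod reg_map (@res_map)).
- exact: res_mod_injective.
- exact: reg_map_inj.
- by move=> w; rewrite res_map_ker reg_map_img.
- by move=> k w; rewrite res_map_ker res_map_img.
- exact: reg_map_essential.
- exact: res_map_essential.
Defined.

Lemma dom_dim_ge1 : dom_dim_ge (A^o : lmodType A) 1.
Proof.
by exists regular_resolution => -[|//] _; apply: res_mod0_projective.
Qed.

Definition regular_mod : fdmod A := FdMod (regular_fin_dim B).

(** If A were injective, its embedding into the envelope would have a retraction
    h, with kernel meeting the image of A trivially, hence zero by essentiality.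
    But the row of the last vertex n - 1 (counting from zero) of the envelope
    contains n - 2, since arrows are nonzero, whereas the row of A does not; so
    the unit vector there minus its retract is a nonzero vector of the kernel. *)
Lemma regular_not_injective : (2 <= n)%N -> ~ injective_mod regular_mod.
Proof.
move=> n2 injA.
have [h hK] := injA regular_mod (res_mod 0) reg_map idfun reg_map_inj.
have lt1 : (n.-1 < n)%N by lia.
have lt2 : (n.-2 < n)%N by lia.
pose i1 := Ordinal lt1; pose i2 := Ordinal lt2.
have nz21 : B i2 i1.
  have e : n.-1 = n.-2.+1 by lia.
  by rewrite /= [X in B _ X]e; apply: nz_arrow; lia.
have H : hull_shape 0 i1 i2.
  apply/hullP; exists n.-1; split=> //; first exact: (nz_vertex B lt1).
  by rewrite prednK 1?ltnW //; apply/negP=> /nz_lt; rewrite ltnn.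
pose w : res_mod 0 := unit_vec (hull_shape 0) (i1, i2).
pose w' : res_mod 0 := w - reg_map (h w).
have nz_w' : w' != 0.
  apply/eqP=> /(congr1 (fun u : res_mod 0 => entry u i1 i2)).
  have -> : entry (0 : interval_mod (hull_shape 0)) i1 i2 = 0.
    by rewrite /entry raddf0 mxE.
  rewrite /w' -scaleN1r entryD.
  have -> : entry (-1 *: reg_map (h w)) i1 i2 = 0.
    rewrite -linearZ reg_mapE coef0 //; apply/negP=> /nz_le /=; lia.
  rewrite restrictE H mxE !eqxx addr0 => /eqP; exact/negP/oner_neq0.
have [||x [hx nzx]] := reg_map_essential (N := fun u => h u = 0).
- by split=> [|a u v u0 v0]; rewrite ?linear0 // linearP u0 v0 scaler0 addr0.
- by exists w' => //; rewrite linearB hK subrr.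
by case/eqP: nzx; rewrite -[x]hK hx linear0.
Qed.

End Resolution.

(** * The length of minimal injective resolutions *)

Section UpperBound.
Variables (K : fieldType) (n : nat) (A : algType K) (B : path_basis n A).
Implicit Types (i j s t : 'I_n).

(** A vector w at vertex j of a module that vanishes at all later vertices spans
    a submodule of dimension at most one over K, which meets the image of an
    essential map only by being contained in it. *)
Lemma sink_in_image (X Y : lmodType A) (f : {linear X -> Y}) j (w : Y) :
  essential_image f -> pth B j j *: w = w ->
  (forall j' (v : Y), (j < j')%N -> pth B j' j' *: v = 0) ->
  exists x, f x = w.
Proof.
move=> ess_f ejw sink.
have [->|nzw] := eqVneq w 0; first by exists 0; rewrite linear0.
have act_w (a : A) : a *: w = (coef B a j j)%:A *: w.
  rewrite -{1}ejw scalerA mul_pth // scaler_suml (bigD1 j) //= algZ ejw.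
  rewrite big1 ?addr0 // => t nt.
  have [lt_jt|lt_tj|e] := ltngtP j t; last by rewrite (val_inj e) eqxx in nt.
    by rewrite algZ -(pth_comp B (ltnW lt_jt) (leqnn t)) -scalerA sink ?scaler0.
  by rewrite coef_lt0 // !scale0r.
have [||x [[c fx] nzfx]] := ess_f (fun y => exists c : K, y = c%:A *: w).
- split=> [|a u v [c ->] [c' ->]]; first by exists 0; rewrite algZ0.
  by exists (coef B a j j * c + c'); rewrite -algZC act_w algZDl algZA mulrC.
- by exists w => //; exists 1; rewrite algZ1.
have nzc : c != 0 by apply: contraNneq nzfx => c0; rewrite fx c0 algZ0.
by exists (c^-1%:A *: x); rewrite linearZ fx /= algZA mulVf // algZ1.
Qed.

(** If the term of index k lives at the vertices below n - k, then no vertex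
    after n - k - 1 occurs in it. Let j be the last vertex of the next term and
    suppose that j is at least n - k - 1. A vector there is the image of some x
    at vertex j of the term of index k, by minimality. As j is last in that term
    as well, x comes from the term before, so its image is zero by exactness. *)
Lemma resolution_support (M : lmodType A) (Rz : min_inj_resolution M) k j
    (v : res_term Rz k) : (n <= j + k)%N -> pth B j j *: v = 0.
Proof.
have idem t (Y : lmodType A) (y : Y) : pth B t t *: (pth B t t *: y) =
  pth B t t *: y.
  by rewrite scalerA pth_comp.
elim: k j v => [|k IHk] j v; first by have := ltn_ord j; lia.
move: {-1}(n - j)%N (leqnn (n - j)) => b.
elim: b j v => [|b IHb] j v le_b le_n; first by have := ltn_ord j; lia.
have [|x dx] := @sink_in_image _ _ (res_diff Rz k) j _ (@res_min _ _ _ Rz k)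
  (idem j _ v).
  by move=> j' v' lt_j; apply: IHb; lia.
have -> : pth B j j *: v = res_diff Rz k (pth B j j *: x).
  by rewrite linearZ /= dx idem.
case: k => [|k] in IHk IHb v le_n x dx *.
  have [|y <-] := @sink_in_image _ _ _ j _ (@res_min0 _ _ _ Rz) (idem j _ x).
    by move=> j' v' lt_j; apply: IHk; lia.
  by apply: (@res_exact0 _ _ _ Rz _).2; exists y.
have [|y <-] := @sink_in_image _ _ _ j _ (@res_min _ _ _ Rz k) (idem j _ x).
  by move=> j' v' lt_j; apply: IHk; lia.
by apply: (@res_exact _ _ _ Rz k _).2; exists y.
Qed.

Lemma resolution_length (M : lmodType A) (Rz : min_inj_resolution M)
    (v : res_term Rz n) : v = 0.
Proof.
rewrite -[v]scale1r (pth_one B) scaler_suml big1 // => j _.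
by apply: resolution_support; apply: leq_addl.
Qed.

(** The differential into the zero term of index n is regular. Projectivity of
    the terms carries regularity down to the augmentation, which is injective
    and so exhibits M as a retract of the first term. *)
Lemma dom_dim_injective (M : fdmod A) :
  (0 < n)%N -> dom_dim_ge M n -> injective_mod M.
Proof.
move=> n0 [Rz proj].
have reg_diff k : (k < n)%N -> regular_map (res_diff Rz k).
  move=> lt_kn; move: {-1}(n - k.+1)%N (erefl (n - k.+1)%N) => b.
  elim: b k lt_kn => [|b IHb] k lt_kn eb.
    have ek : n = k.+1 by lia.
    exists [the {linear _ -> _} of \0] => x; rewrite linear0.
    move: (res_diff Rz k x); rewrite -ek => y.
    by rewrite (resolution_length y).
  have lt_k : (k.+1 < n)%N by lia.
  apply: regular_pred (proj _ lt_k) (@res_exact _ _ _ Rz k) (IHb _ lt_k _); lia.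
have [s augK] := regular_pred (X :=
  M) (proj 0 n0) (@res_exact0 _ _ _ Rz) (reg_diff 0 n0).
move=> X Y g f inj_g.
have [h hg] := @res_injective _ _ _ Rz 0 X Y g (res_aug Rz \o f) inj_g.
exists (s \o h) => x /=; apply: (@res_aug_inj _ _ _ Rz).
by rewrite hg /= augK.
Qed.

End UpperBound.

(** * Bounds on the dominant dimension *)

Lemma exists_last (P : nat -> Prop) n : P 1 -> (1 <= n)%N -> ~ P n ->
  exists2 d, P d /\ ~ P d.+1 & (1 <= d <= n - 1)%N.
Proof.
move=> P1; elim: n => // -[|n] IHn _ nP //.
have [Pn|nPn] := classic (P n.+1); first by exists n.+1 => //; lia.
by have [//|//|d Pd le_d] := IHn; exists d => //; lia.
Qed.

Theorem theorem4p3 (K : fieldType) (n : nat) (hn : (3 <= n)%N)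
    (I : path_algebra K n -> Prop)
    (hadm : admissible I) (hrel : generated_by_zero_relations I)
    (A : algType K) (pi : path_algebra K n -> A)
    (hA : is_quotient_algebra I pi) :
  exists2 d : nat, alg_dom_dim_is A (Some d) & (1 <= d <= n - 1)%N.
Proof.
case: hrel => rho rho_long I_gen.
pose B := quotient_basis rho_long I_gen hA.
have [||d [ge_d nge_d] le_d] := exists_last (n := n) (dom_dim_ge1 B).
- by apply: leq_trans hn.
- move=> ge_n; apply: (@regular_not_injective _ _ _ B); first exact: ltnW.
  by apply: (dom_dim_injective B); first exact: leq_trans hn.
by exists d => //; case: d le_d ge_d nge_d.
Qed.
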